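(* There is a constant $c>0$ such that there are infinitely many square-free positive integers $m$ that are prime-avoiding with constant $c$, i.e. such that $m+u$ is composite for every integer $u$ with $$|u|\le c\,\frac{\log m\,\log\log m\,\log\log\log\log m}{(\log\log\log m)^2}.$$
   Context: An integer $m$ is called prime-avoiding with constant $c$ if $m+u$ is composite for all integers $u$ satisfying $|u|\le c\,\frac{\log m\log_2 m\log_4 m}{(\log_3 m)^2}$, where $\log_2 x=\log\log x$, $\log_3 x=\log\log\log x$, $\log_4x=\log\log\log\log x$. *)

(* Defs.v *)
From mathcomp Require Import all_boot all_order all_algebra.
From mathcomp Require Import classical_sets cardinality reals exp.

Set Implicit Arguments.
Unset Strict Implicit.
Unset Printing Implicit Defensive.

Import Order.TTheory GRing.Theory Num.Theory.

Local Open Scope ring_scope.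

Definition composite (n : int) : bool := (1 < n) && ~~ prime `|n|%N.

Definition squarefree (m : nat) : Prop :=
  forall d : nat, (d ^ 2 %| m)%N -> d = 1%N.

(* [ln] is total, with [ln x = 0] for [x <= 0], and division by 0 gives 0, so
   the bound has an arbitrary value at the finitely many positive integers [m]
   for which [ln (ln (ln (ln m%:~R)))] or the quotient is undefined. *)
Definition avoidance_bound (R : realType) (m : int) : R :=
  let log1 : R := ln m%:~R in
  let log2 := ln log1 in
  let log3 := ln log2 in
  let log4 := ln log3 in
  log1 * log2 * log4 / log3 ^+ 2.

Definition prime_avoiding (R : realType) (c : R) (m : int) : Prop :=
  forall u : int, `|u|%:~R <= c * avoidance_bound R m -> composite (m + u).

(* Main.v *)
(* Rankin's method.  Write [x = 2 ^ a], [a = 2 ^ b], [b = 2 ^ e], and let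
   [y = 2 ^ (e * 2 ^ (b - e - 8))], which is about
   [exp (c log x logloglog x / loglog x)].  The interval [1, N] with
   [N = e * 2 ^ (a + b - 2 * e - 16)] is covered by one residue class for each
   prime [p <= x].  The class 0 for [y < p <= x / a ^ 2] leaves only [y]-smooth
   numbers, which are rare by Rankin's trick, and numbers with a prime factor
   above [x / a ^ 2]; together at most [32 * N * b / a].  Choosing for each
   [p <= y] the most popular class multiplies the number of survivors by at
   most [\prod_(p <= y) (1 - 1 / p) <= 2 / log2 y].  By Chebyshev the result
   does not exceed the number of primes in [(x / a ^ 2, x]], each of which
   removes one survivor.

   With [M] the product of the primes up to [x], the residue classes are lifted
   to nonzero classes modulo [p ^ 2] and combined into [r] modulo [M ^ 2].  For
   [1 <= t <= 4 * M ^ 2] fewer than [4 * M ^ 2] of the numbers [r + M ^ 2 * t]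
   are divisible by the square of a prime beyond [x], so one of them is
   square-free; its logarithm is [O(x)]. *)

Require Import Defs.
From mathcomp Require Import all_boot all_order all_algebra.
From mathcomp Require Import zify ring lra.
From mathcomp Require Import classical_sets cardinality reals sequences exp.

Set Implicit Arguments.
Unset Strict Implicit.
Unset Printing Implicit Defensive.

Import Order.TTheory GRing.Theory Num.Theory.

Local Open Scope nat_scope.

(** * Chebyshev bounds *)

Lemma prod_primes_dvd (s : seq nat) (n : nat) :
  uniq s -> all prime s -> all (dvdn^~ n) s -> \prod_(p <- s) p %| n.
Proof.
elim: s => [|p s IHs] /=; first by rewrite big_nil.
move=> /andP[ps us] /andP[pp sp] /andP[pn sn]; rewrite big_cons Gauss_dvd.
  by rewrite pn IHs.
rewrite prime_coprime // Euclid_dvd_prod // big_has.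
apply/hasPn => q qs; rewrite dvdn_prime2 //; last exact: (allP sp).
by apply: contraNneq ps => ->.
Qed.

Definition primes_in (m n : nat) : seq nat :=
  [seq p <- index_iota m.+1 n.+1 | prime p].

Lemma mem_primes_in (m n p : nat) :
  (p \in primes_in m n) = [&& prime p, m < p & p <= n].
Proof. by rewrite mem_filter mem_index_iota. Qed.

Lemma primes_in_uniq (m n : nat) : uniq (primes_in m n).
Proof. by rewrite filter_uniq // iota_uniq. Qed.

Lemma primes_in_prime (m n : nat) : all prime (primes_in m n).
Proof. exact: filter_all. Qed.

Lemma primes_in_cat (l m n : nat) :
  l <= m -> m <= n -> primes_in l n = primes_in l m ++ primes_in m n.
Proof.
move=> lm mn; rewrite /primes_in -filter_cat /index_iota !subSS.
have -> : n - l = (m - l) + (n - m) by lia.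
by rewrite iotaD; have -> : l.+1 + (m - l) = m.+1 by lia.
Qed.

(** Such a prime divides the factorial of [n.*2] but not that of [n], hence it divides their
    binomial quotient. *)
Lemma prod_primes_block (n : nat) :
  \prod_(p <- primes_in n n.*2) p %| 'C(n.*2, n).
Proof.
apply: prod_primes_dvd; rewrite ?primes_in_uniq ?primes_in_prime //.
apply/allP => p; rewrite mem_primes_in => /and3P[pp np pn].
have : p %| 'C(n.*2, n) * (n`! * (n.*2 - n)`!).
  rewrite bin_fact -?addnn ?leq_addr //.
  by apply: dvdn_fact; rewrite prime_gt0 //= addnn.
have pF : p %| n`! = false.
  rewrite fact_prod Euclid_dvd_prod // big_has; apply/negbTE/hasPn => i.
  by rewrite mem_index_iota => /andP[i0 ni]; rewrite gtnNdvd //; lia.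
by rewrite -addnn addnK !Euclid_dvdM // pF !orbF addnn.
Qed.

Lemma central_bin_le (n : nat) : 'C(n.*2, n) <= 2 ^ n.*2.
Proof.
have := expnDn 1 1 n.*2; rewrite addn1 => ->.
rewrite (bigD1 (inord n)) //= inordK; last by lia.
by rewrite !exp1n !muln1 leq_addr.
Qed.

(** Pascal's rule and symmetry split the next central coefficient into two terms, each at least the
    current one. *)
Lemma central_bin_ge (n : nat) : 2 ^ n <= 'C(n.*2, n).
Proof.
elim: n => [|n IHn]; first by rewrite bin0.
rewrite doubleS binS expnS mul2n -addnn; apply: leq_add.
  by rewrite binS; apply: leq_trans IHn _; exact: leq_addl.
rewrite -(@bin_sub _ n); last by lia.
have -> : n.*2.+1 - n = n.+1 by lia.
by rewrite binS; apply: leq_trans IHn _; exact: leq_addl.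
Qed.

(** The block [(2 ^ a, 2 ^ a.+1]] contributes at most [2 ^ 2 ^ a.+1], by the central binomial
    coefficient, and the exponents add up geometrically. *)
Lemma primorial_le (a : nat) :
  \prod_(p <- primes_in 0 (2 ^ a)) p <= 2 ^ (2 ^ a.+1).
Proof.
elim: a => [|a IHa]; first by rewrite /primes_in /= big_nil.
rewrite (@primes_in_cat _ (2 ^ a)) ?leq_exp2l // big_cat /=.
have -> : 2 ^ 2 ^ a.+2 = 2 ^ 2 ^ a.+1 * 2 ^ (2 ^ a).*2.
  by rewrite -expnD -mul2n -expnS addnn -mul2n -expnS.
apply: leq_mul => //; apply: leq_trans (central_bin_le _).
by rewrite expnS mul2n dvdn_leq ?prod_primes_block // bin_gt0; lia.
Qed.

(** By Legendre's formula the exponent of [p] is the sum over [k] of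
    [n.*2 %/ p ^ k - 2 * (n %/ p ^ k)]; each term is at most 1 and vanishes once [p ^ k] exceeds
    [n.*2]. *)
Lemma pfactor_bin_le (p n : nat) :
  prime p -> 0 < n -> p ^ logn p 'C(n.*2, n) <= n.*2.
Proof.
move=> pp n0; have p1 := prime_gt1 pp.
have n20 : 0 < n.*2 by lia.
suff logle : logn p 'C(n.*2, n) <= trunc_log p n.*2.
  apply: leq_trans (trunc_logP p1 n20); by rewrite leq_exp2l.
have : logn p 'C(n.*2, n) + 2 * logn p n`! = logn p (n.*2)`!.
  rewrite -(@bin_fact n.*2 n); last by lia.
  rewrite -addnn addnK !lognM ?muln_gt0 ?fact_gt0 ?bin_gt0 //; lia.
rewrite !logn_fact //.
have -> : \sum_(1 <= k < n.+1) n %/ p ^ k = \sum_(1 <= k < n.*2.+1) n %/ p ^ k.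
  rewrite [in RHS](@big_cat_nat _ _ _ n.+1) //=; last by lia.
  rewrite [X in _ = _ + X]big_nat_cond [X in _ = _ + X]big1 ?addn0 //.
  move=> i /andP[/andP[ni _] _].
  by rewrite divn_small //; apply: leq_trans (ltn_expl _ p1); lia.
move=> E; have : logn p 'C(n.*2, n) <= \sum_(1 <= k < n.*2.+1) (p ^ k <= n.*2).
  rewrite -(leq_add2r (2 * \sum_(1 <= k < n.*2.+1) n %/ p ^ k)) E.
  rewrite big_distrr -big_split /=; apply: leq_sum => i _.
  have [|lt] := leqP (p ^ i) n.*2; last by rewrite divn_small.
  have : 0 < p ^ i by rewrite expn_gt0 prime_gt0.
  move: (p ^ i) => q q0 _; rewrite -ltnS -addn1 addnC addnA ltn_divLR //.
  have := ltn_ceil n q0; nia.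
move/leq_trans; apply.
set L := trunc_log p n.*2.
have L1 : L <= n.*2.
  apply: leq_trans (trunc_logP p1 n20); exact/ltnW/ltn_expl.
rewrite (@big_cat_nat _ _ _ L.+1) //= [X in _ + X]big_nat_cond.
rewrite [X in _ + X]big1 ?addn0.
  apply: (@leq_trans (\sum_(1 <= k < L.+1) 1)).
    by apply: leq_sum => i _; exact: leq_b1.
  by rewrite sum_nat_const_nat; lia.
move=> i /andP[/andP[Li _] _]; rewrite leqNgt.
by rewrite (leq_trans (trunc_log_ltn n.*2 p1)) // leq_exp2l.
Qed.

(** For [n = 2 ^ k] the central coefficient is at least [2 ^ n], and it is a product of prime
    powers, one for each prime up to [2 ^ k.+1] and none above [2 ^ k.+1]. Comparing exponents of 2
    gives the bound. *)
Lemma chebyshev_lower (k : nat) :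
  2 ^ k <= k.+1 * size (primes_in 0 (2 ^ k.+1)).
Proof.
set n := 2 ^ k; have n0 : 0 < n by rewrite expn_gt0.
have n2 : 2 ^ k.+1 = n.*2 by rewrite expnS mul2n.
rewrite -(@leq_exp2l 2) //; apply: leq_trans (central_bin_ge n) _.
have C0 : 0 < 'C(n.*2, n) by rewrite bin_gt0; lia.
(* The factorisation is indexed far enough to be cut at [n.*2]; beyond that every exponent is 0. *)
rewrite -(partnT C0) (@widen_partn ('C(n.*2, n) + n.*2)) ?leq_addr //.
rewrite (@big_cat_nat _ _ _ n.*2.+1) //=; last by rewrite ltnS leq_addl.
rewrite [X in _ * X]big_nat_cond [X in _ * X]big1 ?muln1; last first.
  move=> p /andP[/andP[np _] _]; case: (boolP (prime p)) => [pp|/negbTE np'].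
    have := @pfactor_bin_le p n pp n0; case: (logn _ _) => // i.
    move=> /leq_ltn_trans/(_ np); rewrite expnS ltnNge leq_pmulr //.
    by rewrite expn_gt0 prime_gt0.
  by rewrite lognE np'.
rewrite (@big_ltn _ _ _ 0) //= lognE /= mul1n (bigID prime) /=.
rewrite [X in _ * X]big1 ?muln1 => [|p /negbTE np]; last by rewrite lognE np.
rewrite expnM n2 -big_filter -/(primes_in 0 _) -iter_muln_1 -count_predT.
rewrite -big_const_seq !big_seq -n2 expnS mul2n -/n; apply: leq_prod => p.
by rewrite mem_primes_in => /and3P[pp _ _]; exact: pfactor_bin_le.
Qed.

Lemma count_has_le (T I : Type) (B : I -> pred T) (s : seq I) (l : seq T) :
  count (fun t => has (B^~ t) s) l <= \sum_(i <- s) count (B i) l.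
Proof.
elim: s => [|i s IHs]; first by rewrite big_nil /= count_pred0.
rewrite big_cons; apply: leq_trans (leq_add (leqnn _) IHs).
by rewrite -count_predUI leq_addr.
Qed.

Local Open Scope ring_scope.

(** * Sums over primes *)

(** Every prime of the block exceeds [2 ^ k], while their product is at most [2 ^ 2 ^ k.+1]. *)
Lemma size_primes_block (k : nat) :
  (k * size (primes_in (2 ^ k) (2 ^ k.+1)) <= 2 ^ k.+1)%N.
Proof.
rewrite -(@leq_exp2l 2) // expnM expnS mul2n.
apply: (@leq_trans 'C((2 ^ k).*2, 2 ^ k)); last exact: central_bin_le.
apply: leq_trans (dvdn_leq _ (prod_primes_block _)); last first.
  by rewrite bin_gt0 -addnn leq_addr.
rewrite -iter_muln_1 -count_predT -big_const_seq !big_seq.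
by apply: leq_prod => p; rewrite mem_primes_in => /and3P[_ /ltnW].
Qed.

(** The denominator [k.+1], bought with a factor 2, covers the block [k = 0] as well. *)
Lemma sum_inv_primes_block (R : realFieldType) (k : nat) :
  \sum_(p <- primes_in (2 ^ k) (2 ^ k.+1)) p%:R^-1 <= 4 / k.+1%:R :> R.
Proof.
have k2 : 0 < (2 ^ k)%:R :> R by rewrite ltr0n expn_gt0.
have le : \sum_(p <- primes_in (2 ^ k) (2 ^ k.+1)) p%:R^-1
    <= (size (primes_in (2 ^ k) (2 ^ k.+1)))%:R / (2 ^ k)%:R :> R.
  rewrite mulr_natl -iter_addr_0 -count_predT -big_const_seq !big_seq.
  apply: ler_sum => p; rewrite mem_primes_in => /and3P[_ kp _].
  have p0 : 0 < p%:R :> R by rewrite ltr0n (leq_trans _ kp).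
  by rewrite lef_pV2 ?posrE // ler_nat ltnW.
apply: le_trans le _; have := size_primes_block k; case: k k2 => [|k] k2 sz.
  by rewrite /primes_in /= expn0 divr1 ler_pdivlMr //; lra.
rewrite ler_pdivrMr // mulrAC ler_pdivlMr ?ltr0n // -!natrM ler_nat.
move: sz; rewrite (expnS 2 k.+1); set s := size _; set q := (2 ^ k.+1)%N; nia.
Qed.

Lemma sum_primes_dyadic (R : realFieldType) (f c : nat -> R) (m n : nat) :
  (m <= n)%N ->
  (forall k, (m <= k < n)%N ->
    \sum_(p <- primes_in (2 ^ k) (2 ^ k.+1)) f p <= c k) ->
  \sum_(p <- primes_in (2 ^ m) (2 ^ n)) f p <= \sum_(m <= k < n) c k.
Proof.
move=> mn; rewrite -(subnKC mn); elim: (n - m)%N => [|d IHd] fc.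
  rewrite addn0 big_geq // big_seq big1 // => p.
  by rewrite mem_primes_in => /and3P[_]; case: ltngtP.
rewrite addnS big_nat_recr ?leq_addr //=.
rewrite (@primes_in_cat _ (2 ^ (m + d))) ?leq_exp2l ?leq_addr //.
rewrite big_cat /=; apply: lerD; last by apply: fc; rewrite addnS leq_addr /=.
by apply: IHd => k /andP[mk kd]; apply: fc; rewrite mk addnS ltnS ltnW.
Qed.

(** The left side is [t - 1] times a geometric sum of [k.+1] terms, none above [t ^+ k]. *)
Lemma exprB1_le (R : realFieldType) (t : R) (k : nat) :
  1 <= t -> t ^+ k.+1 - 1 <= k.+1%:R * (t ^+ k * (t - 1)).
Proof.
move=> t1; elim: k => [|k IHk]; first by rewrite expr1 expr0 mul1r mul1r.
have tk : 0 <= t ^+ k by rewrite exprn_ge0 //; lra.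
have k0 : 0 <= k.+1%:R :> R by rewrite ler0n.
rewrite -[k.+2%:R]natr1.
rewrite !exprS; rewrite !exprS in IHk.
move: (t ^+ k) tk IHk => u u0; move: (k.+1%:R) k0 => z z0 IHk.
have e : t * (t * u) - 1 = t * u * (t - 1) + (t * u - 1) by lra.
have zu : 0 <= z * u * (t - 1) * (t - 1).
  by rewrite !mulr_ge0 // subr_ge0.
by rewrite e; lra.
Qed.

(** Each [t ^+ k.+1 / k.+1] is [1 / k.+1] plus at most [t ^+ k * (t - 1)], by [exprB1_le], and the
    latter telescopes to [t ^+ w - 1]. *)
Lemma sum_geometric_over (R : realFieldType) (t : R) (w : nat) : 1 <= t ->
  \sum_(0 <= k < w) 4 / k.+1%:R * t ^+ k.+1
  <= 4 * (\sum_(0 <= k < w) k.+1%:R^-1 + t ^+ w - 1).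
Proof.
move=> t1; elim: w => [|w IHw]; first by rewrite !big_geq // expr0; lra.
rewrite !big_nat_recr //=.
have w0 : 0 < w.+1%:R :> R by rewrite ltr0n.
suff : w.+1%:R^-1 * t ^+ w.+1 <= w.+1%:R^-1 + t ^+ w * (t - 1).
  rewrite !exprS; move: (w.+1%:R^-1) (t ^+ w) IHw => i u.
  by move: (\sum_(_ <= _ < _) _) (\sum_(_ <= _ < _) _) => x y; lra.
have := exprB1_le w t1; rewrite -(ler_pM2l (_ : 0 < w.+1%:R^-1)) ?invr_gt0 //.
rewrite mulKf ?gt_eqF //; move: (t ^+ w.+1) (t ^+ w) (w.+1%:R^-1) => x y z.
by lra.
Qed.

Lemma harmonic_dyadic (R : realFieldType) (w : nat) :
  w%:R / 2 <= \sum_(1 <= n < (2 ^ w).+1) n%:R^-1 :> R.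
Proof.
elim: w => [|w IHw].
  by rewrite mul0r sumr_ge0 // => i _; rewrite invr_ge0.
rewrite (@big_cat_nat _ _ _ (2 ^ w).+1) //= ?ltnS ?leq_exp2l //.
rewrite -[w.+1%:R]natr1 mulrDl; apply: lerD => //.
rewrite mul1r; have k2 : 0 < (2 ^ w)%:R :> R by rewrite ltr0n expn_gt0.
apply: (@le_trans _ _
  (\sum_((2 ^ w).+1 <= n < (2 ^ w.+1).+1) (2 ^ w.+1)%:R^-1)).
  rewrite sumr_const_nat subSS expnS mul2n -addnn addnK -mulr_natl natrD.
  rewrite le_eqVlt; apply/orP; left; apply/eqP; field; lra.
apply: ler_sum_nat => i /andP[wi iw].
rewrite lef_pV2 ?posrE ?ltr0n ?ler_nat ?expn_gt0 //.
exact: leq_ltn_trans wi.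
Qed.

Lemma harmonic_dyadic_le (R : realFieldType) (w : nat) :
  \sum_(0 <= k < 2 ^ w) k.+1%:R^-1 <= w%:R + 1 :> R.
Proof.
elim: w => [|w IHw]; first by rewrite expn0 big_nat1 invr1; lra.
rewrite (@big_cat_nat _ _ _ (2 ^ w)) //= ?leq_exp2l //.
rewrite -[w.+1%:R]natr1; apply: lerD => //.
have k2 : 0 < (2 ^ w)%:R :> R by rewrite ltr0n expn_gt0.
apply: (@le_trans _ _ (\sum_(2 ^ w <= n < 2 ^ w.+1) (2 ^ w)%:R^-1)).
  apply: ler_sum_nat => i /andP[wi iw].
  by rewrite lef_pV2 ?posrE ?ltr0n ?ler_nat ?expn_gt0 // ltnW.
rewrite sumr_const_nat expnS mul2n -addnn addnK -mulr_natl.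
rewrite le_eqVlt; apply/orP; left; apply/eqP; field; lra.
Qed.

Lemma sum_multiples (V : nmodType) (N p : nat) (F : nat -> V) : (0 < p)%N ->
  \sum_(1 <= n < N.+1 | (p %| n)%N) F n
  = \sum_(1 <= m < (N %/ p).+1) F (p * m)%N.
Proof.
move=> p0; elim: N => [|N IHN]; first by rewrite div0n !big_geq.
rewrite big_mkcond big_nat_recr //= -big_mkcond /= IHN divnS //.
case: ifP => [pN|pN]; last by rewrite add0n addr0.
rewrite add1n [RHS]big_nat_recr //=; congr (_ + F _).
by rewrite -{1}(divnK pN) mulnC divnS // pN.
Qed.

(* The terms divisible by [p] contribute at most [g p] times the whole sum;
   removing them leaves the sum over [s]. *)
Lemma euler_product_ge (R : realFieldType) (g : nat -> R) (s : seq nat)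
    (N : nat) :
  (forall n, 0 <= g n) -> {morph g : m n / (m * n)%N >-> m * n} -> g 1%N = 1 ->
  all prime s -> all (fun p => g p < 1) s ->
  \sum_(1 <= n < N.+1 | all (mem s) (primes n)) g n
  <= \prod_(p <- s) (1 - g p)^-1.
Proof.
move=> g0 gM g1; elim: s => [_ _|p s IHs] /=.
  rewrite big_nil; case: N => [|N]; first by rewrite big_geq.
  rewrite big_mkcond big_ltn //= g1 big_nat_cond big1 ?addr0 //.
  move=> n /andP[/andP[n1 _] _]; case: ifP => //; case E: (primes n) => //.
  by move/eqP: E; rewrite primes_eq0; lia.
move=> /andP[pp sp] /andP[gp gs]; rewrite big_cons.
rewrite -(ler_pM2l (_ : 0 < 1 - g p)) ?subr_gt0 //.
rewrite mulrA divff ?mul1r; last by rewrite subr_eq0 eq_sym lt_eqF.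
set S := (X in _ * X <= _).
suff le : S <= g p * S + \sum_(1 <= n < N.+1 | all (mem s) (primes n)) g n.
  by rewrite mulrBl mul1r lerBlDl (le_trans le) // lerD2l IHs.
rewrite {1}/S (bigID (dvdn p)) /=; apply: lerD; last first.
  rewrite big_mkcond [leRHS]big_mkcond /=; apply: ler_sum_nat => n /andP[n0 _].
  case: ifP => [/andP[/allP ns pn]|_]; last by case: ifP.
  suff -> : all (mem s) (primes n) by [].
  apply/allP => q qn; have := ns _ qn; rewrite inE => /orP[/eqP qp|//].
  by move: qn; rewrite qp mem_primes (negbTE pn) !andbF.
(* With [n = p * m], the cofactor [m] still has all its primes in [p :: s], and [m <= N %/ p] lies
   in the original range. *)
rewrite big_mkcondl /= sum_multiples ?prime_gt0 // /S mulr_sumr big_mkcond /=.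
rewrite [leRHS]big_mkcond.
apply: (@le_trans _ _ (\sum_(1 <= m < (N %/ p).+1)
    (if all (mem (p :: s)) (primes m) then g p * g m else 0))).
  apply: ler_sum_nat => m /andP[m0 _].
  case: ifP => [/allP pm|_]; last by case: ifP => // _; rewrite mulr_ge0.
  rewrite gM; suff -> : all (mem (p :: s)) (primes m) by [].
  apply/allP => q; rewrite mem_primes => /and3P[qp _ qm]; apply: pm.
  by rewrite mem_primes qp muln_gt0 prime_gt0 // m0 dvdn_mull.
rewrite [leRHS](@big_cat_nat _ _ _ (N %/ p).+1) ?ltnS ?leq_div //=.
by rewrite lerDl sumr_ge0 // => m _; case: ifP => // _; rewrite mulr_ge0.
Qed.

(** Every [n <= 2 ^ w] has only primes up to [2 ^ w], so the inverse product dominates the harmonic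
    sum, which is at least [w / 2]. *)
Lemma mertens_le (R : realFieldType) (w : nat) : (0 < w)%N ->
  \prod_(p <- primes_in 0 (2 ^ w)) (1 - p%:R^-1) <= 2 / w%:R :> R.
Proof.
move=> w0; have w0' : 0 < w%:R :> R by rewrite ltr0n.
have le1 p : prime p -> p%:R^-1 < 1 :> R.
  by move=> pp; rewrite invf_lt1 ?ltr0n ?ltr1n ?prime_gt0 ?prime_gt1.
have := @euler_product_ge R (fun n => n%:R^-1) (primes_in 0 (2 ^ w)) (2 ^ w).
rewrite invr1 primes_in_prime => /(_ _ _ erefl isT) H.
have {}H : \sum_(1 <= n < (2 ^ w).+1) n%:R^-1
    <= \prod_(p <- primes_in 0 (2 ^ w)) (1 - p%:R^-1)^-1 :> R.
  apply: le_trans (H _ _ _) => [|n|m n|]; rewrite ?invr_ge0 //.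
  - rewrite [leRHS]big_mkcond; apply: ler_sum_nat => n /andP[n0 nw].
    suff -> : all (mem (primes_in 0 (2 ^ w))) (primes n) by [].
    apply/allP => p; rewrite mem_primes => /and3P[pp _ pn].
    by rewrite inE mem_primes_in pp prime_gt0 // (leq_trans (dvdn_leq _ pn)).
  - by rewrite natrM invfM.
  - by apply/allP => p; rewrite mem_primes_in => /andP[/le1].
have {}H := le_trans (harmonic_dyadic R w) H.
move: H; rewrite prodfV; set P := \prod_(_ <- _) _.
have P0 : 0 < P.
  rewrite /P big_seq; apply: prodr_gt0 => p.
  by rewrite mem_primes_in => /andP[/le1]; rewrite subr_gt0.
by rewrite -invf_div lef_pV2 ?posrE ?divr_gt0.
Qed.

(** * Smooth numbers *)

(** On this range [(1 - x) * (1 + 4 * x) >= 1], with equality at both ends. *)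
Lemma inv1B_le_expR (R : realType) (x : R) :
  0 <= x <= 3 / 4 -> (1 - x)^-1 <= expR (4 * x).
Proof.
move=> /andP[x0 x1]; apply: le_trans (expR_ge1Dx _).
by rewrite -[X in X <= _]mul1r ler_pdivrMr; nra.
Qed.

(** For positive [n] this is [n ^ (eta - 1)]; it is completely multiplicative, as [euler_product_ge]
    requires. *)
Definition rankin_weight (R : realType) (eta : R) (n : nat) : R :=
  n%:R^-1 * n%:R `^ eta.

(** The weight is at most [1 / sqrt p <= 1 / sqrt 2 < 3 / 4], which is the range of
    [inv1B_le_expR]. *)
Lemma rankin_weight_prime (R : realType) (eta : R) (p : nat) :
  0 <= eta <= 2^-1 -> prime p -> 0 <= rankin_weight eta p <= 3 / 4.
Proof.
move=> /andP[e0 e1] pp; have p2 : 2 <= p%:R :> R by rewrite ler_nat prime_gt1.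
have p0 : 0 < p%:R :> R by lra.
rewrite mulr_ge0 ?invr_ge0 ?powR_ge0 ?ler0n //= ler_pdivrMl //.
apply: le_trans (ler_powR _ e1) _; first by lra.
rewrite powR12_sqrt ?(ltW p0) // -ler_sqr ?nnegrE ?sqrtr_ge0 //; last by lra.
by rewrite sqr_sqrtr ?(ltW p0) //; nra.
Qed.

(** Let [t] be 2 to the power [eta]. On the block [(2 ^ k, 2 ^ k.+1]] the weight is at most
    [t ^+ k.+1 / p], so the dyadic sum is that of [sum_geometric_over]; the 16 is 4 from there times
    4 from [inv1B_le_expR]. *)
Lemma rankin_product_le (R : realType) (eta : R) (w : nat) :
  0 <= eta <= 2^-1 ->
  \prod_(p <- primes_in 0 (2 ^ w)) (1 - rankin_weight eta p)^-1
  <= expR (16 * (\sum_(0 <= k < w) k.+1%:R^-1 + (2 `^ eta) ^+ w)).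
Proof.
move=> eta01; have /andP[e0 e1] := eta01.
have t1 : 1 <= 2 `^ eta :> R.
  by have := @ler_powR _ 2 _ _ _ e0; rewrite powRr0; apply; lra.
apply: (@le_trans _ _ (\prod_(p <- primes_in 0 (2 ^ w))
    expR (4 * rankin_weight eta p))).
  rewrite big_seq [leRHS]big_seq; apply: ler_prod => p.
  rewrite mem_primes_in => /andP[pp _].
  have /andP[g0 g1] := rankin_weight_prime eta01 pp.
  by rewrite inv1B_le_expR ?g0 // andbT invr_ge0; lra.
rewrite -expR_sum ler_expR -mulr_sumr.
suff : \sum_(p <- primes_in 0 (2 ^ w)) rankin_weight eta p
    <= \sum_(0 <= k < w) 4 / k.+1%:R * (2 `^ eta) ^+ k.+1.
  move=> /le_trans/(_ (sum_geometric_over w t1)).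
  move: (_ ^+ w) (\sum_(0 <= k < w) _) (\sum_(_ <- _) _) => x y z; lra.
have -> : primes_in 0 (2 ^ w) = primes_in (2 ^ 0) (2 ^ w).
  by rewrite (@primes_in_cat 0 (2 ^ 0)) ?expn_gt0.
apply: sum_primes_dyadic => // k _.
apply: (@le_trans _ _ (\sum_(p <- primes_in (2 ^ k) (2 ^ k.+1))
    p%:R^-1 * (2 `^ eta) ^+ k.+1)).
  rewrite big_seq [leRHS]big_seq; apply: ler_sum => p.
  rewrite mem_primes_in => /and3P[_ kp pk]; rewrite ler_wpM2l ?invr_ge0 //.
  rewrite -powR_mulrn ?powR_ge0 // -powRrM mulrC powRrM powR_mulrn //.
  by rewrite -natrX ge0_ler_powR ?nnegrE ?ler_nat.
by rewrite -mulr_suml ler_wpM2r ?sum_inv_primes_block // exprn_ge0 // powR_ge0.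
Qed.

(* Rankin's trick: each [n] in [(2 ^ L, N]] is counted with the weight
   [N / n * (n / 2 ^ L) `^ eta >= 1]. *)
Lemma smooth_count (R : realType) (eta : R) (w L N : nat) :
  0 <= eta <= 2^-1 ->
  \sum_(1 <= n < N.+1 | all (mem (primes_in 0 (2 ^ w))) (primes n)) 1
  <= (2 ^ L)%:R + N%:R / (2 `^ eta) ^+ L
     * expR (16 * (\sum_(0 <= k < w) k.+1%:R^-1 + (2 `^ eta) ^+ w)).
Proof.
move=> eta01; have /andP[e0 e1] := eta01.
pose P n := all (mem (primes_in 0 (2 ^ w))) (primes n).
pose g := rankin_weight eta.
have gE := @euler_product_ge R g (primes_in 0 (2 ^ w)) N.
have {}gE : \sum_(1 <= n < N.+1 | P n) g n
    <= \prod_(p <- primes_in 0 (2 ^ w)) (1 - g p)^-1.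
  apply: gE => [n|m n|||]; rewrite ?primes_in_prime //.
  - by rewrite mulr_ge0 ?invr_ge0 ?powR_ge0.
  - by rewrite /g /rankin_weight natrM powRM // invfM mulrACA.
  - by rewrite /g /rankin_weight powR1 invr1 mul1r.
  apply/allP => p; rewrite mem_primes_in => /andP[pp _].
  by have /andP[] := rankin_weight_prime eta01 pp; rewrite -/g; lra.
have {}gE := le_trans gE (rankin_product_le w eta01).
have t0 : 0 < (2 `^ eta) ^+ L :> R by rewrite exprn_gt0 // powR_gt0.
have {gE} := ler_wpM2l (_ : 0 <= N%:R / (2 `^ eta) ^+ L) gE.
rewrite divr_ge0 // ?(ltW t0) // => /(_ isT) gE.
apply: le_trans (lerD (lexx _) gE).
rewrite mulr_sumr.
have -> : (2 ^ L)%:R = \sum_(1 <= n < (2 ^ L).+1) 1 :> R.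
  by rewrite sumr_const_nat subn1.
(* Numbers up to [2 ^ L] are counted trivially; in the first case there are no others. *)
have [NL|LN] := leqP N (2 ^ L).
  rewrite -[leLHS]addr0; apply: lerD; last first.
    by apply: sumr_ge0 => n _; rewrite !mulr_ge0 ?invr_ge0 ?powR_ge0 ?(ltW t0).
  rewrite big_mkcond [leRHS](@big_cat_nat _ _ _ N.+1) //= -[leLHS]addr0.
  apply: lerD; last by apply: sumr_ge0.
  by apply: ler_sum => n _; case: ifP.
rewrite (@big_cat_nat _ _ _ (2 ^ L).+1) //=; last by rewrite ltnS ltnW.
apply: lerD.
  by rewrite big_mkcond; apply: ler_sum => n _; case: ifP.
rewrite big_mkcond [leRHS]big_mkcond.
rewrite [leRHS](@big_cat_nat _ _ _ (2 ^ L).+1) //=; last by rewrite ltnS ltnW.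
rewrite -[leLHS]add0r; apply: lerD.
  apply: sumr_ge0 => n _; case: ifP => // _.
  by rewrite !mulr_ge0 ?invr_ge0 ?powR_ge0 ?(ltW t0).
apply: ler_sum_nat => n /andP[Ln nN]; rewrite /P; case: ifP => // _.
have n0 : 0 < n%:R :> R by rewrite ltr0n (leq_trans _ Ln).
have -> : N%:R / (2 `^ eta) ^+ L * g n
    = (N%:R / n%:R) * (n%:R `^ eta / (2 `^ eta) ^+ L).
  by rewrite /g /rankin_weight mulrACA [X in _ * X]mulrC.
apply: (@le_trans _ _ (1 * 1)); first by rewrite mulr1.
apply: ler_pM => //; rewrite ler_pdivlMr // mul1r.
  by rewrite ler_nat.
rewrite -powR_mulrn ?powR_ge0 // -powRrM mulrC powRrM powR_mulrn //.
by rewrite -natrX ge0_ler_powR ?nnegrE ?ler_nat // ltnW.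
Qed.

(** * Covering an interval by residue classes *)

Lemma sum_class_count (p : nat) (S : seq nat) : (0 < p)%N ->
  (\sum_(c < p) count (fun n => n == c %[mod p]) S = size S)%N.
Proof.
move=> p0; elim: S => [|n S IHS] /=; first by rewrite big1.
rewrite big_split /= IHS (bigD1 (Ordinal (ltn_pmod n p0))) //= modn_mod eqxx.
rewrite big1 ?addn0 // => i; rewrite -val_eqE /= (modn_small (ltn_ord i)).
by rewrite eq_sym => /negbTE ->.
Qed.

Lemma popular_class (p : nat) (S : seq nat) : (0 < p)%N ->
  exists c, (size S <= p * count (fun n => n == c %[mod p]) S)%N.
Proof.
move=> p0.
case: (boolP [exists c : 'I_p,
    (size S <= p * count (fun n => n == c %[mod p]) S)%N]).
  by case/existsP => c sz; exists c.
rewrite negb_exists => /forallP lt.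
have : (\sum_(c < p) (p * count (fun n => n == c %[mod p]) S).+1
    <= \sum_(c < p) size S)%N.
  by apply: leq_sum => c _; rewrite ltnNge lt.
rewrite sum_nat_const card_ord -(eq_bigr _ (fun _ _ => addn1 _)) big_split /=.
by rewrite -big_distrr /= sum_class_count // sum1_card card_ord; lia.
Qed.

(** The primes are treated in turn: the most popular class modulo [p] contains at least a fraction
    [1 / p] of what is left. *)
Lemma greedy_sieve (R : realFieldType) (s S : seq nat) :
  uniq s -> all prime s ->
  exists c : nat -> nat,
    (size [seq n <- S | all (fun p => n != c p %[mod p]) s])%:R
    <= (size S)%:R * \prod_(p <- s) (1 - p%:R^-1) :> R.
Proof.
elim: s S => [|p s IHs] S /=.
  by exists (fun=> 0%N); rewrite big_nil mulr1 filter_predT.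
move=> /andP[ps us] /andP[pp sp].
have [c0 c0S] := @popular_class p S (prime_gt0 pp).
have [c cS] := IHs [seq n <- S | n != c0 %[mod p]] us sp.
exists (fun q => if q == p then c0 else c q); rewrite eqxx big_cons mulrA.
have -> : [seq n <- S | (n != c0 %[mod p]) &&
      all (fun q => n != (if q == p then c0 else c q) %[mod q]) s]
    = [seq n <- [seq n <- S | n != c0 %[mod p]]
      | all (fun q => n != c q %[mod q]) s].
  rewrite -filter_predI; apply: eq_filter => n /=; rewrite andbC.
  congr (_ && _); apply: eq_in_all => q qs.
  by case: (eqVneq q p) => // qp; rewrite -qp qs in ps.
apply: le_trans cS _; apply: ler_wpM2r.
  rewrite big_seq prodr_ge0 // => q qs.
  have q1 := prime_gt1 (allP sp q qs).
  by rewrite subr_ge0 invf_le1 ?ltr0n ?ler1n ltnW // ltnW.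
have p0 : 0 < p%:R :> R by rewrite ltr0n prime_gt0.
rewrite -(ler_pM2l p0) mulrCA mulrBr mulr1 divff ?gt_eqF // size_filter.
have := count_predC (fun n => n == c0 %[mod p]) S.
rewrite -[count (predC _) S]/(count (fun n => n != c0 %[mod p]) S).
move: (count (fun n => n != c0 %[mod p]) S) c0S => y.
move: (count _ S) => x c0S xy.
move: c0S; rewrite -xy -(ler_nat R) natrM natrD.
move: (x%:R) (y%:R) => X Y; lra.
Qed.

Lemma large_prime_count (R : realFieldType) (N m l : nat) :
  (m <= l)%N ->
  (count (fun n => has (dvdn^~ n) (primes_in (2 ^ m) (2 ^ l))) (iota 1 N))%:R
  <= N%:R * \sum_(m <= k < l) 4 / k.+1%:R :> R.
Proof.
move=> ml.
apply: (@le_trans _ _ (N%:R * \sum_(p <- primes_in (2 ^ m) (2 ^ l)) p%:R^-1)).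
  rewrite mulr_sumr; set s := primes_in _ _.
  apply: (@le_trans _ _ (\sum_(p <- s) count (dvdn p) (iota 1 N))%:R).
    by rewrite ler_nat; exact: (count_has_le dvdn).
  rewrite natr_sum big_seq [leRHS]big_seq; apply: ler_sum => p.
  rewrite mem_primes_in => /andP[pp _].
  rewrite -sum1_count natr_sum.
  have := @sum_multiples R N p (fun=> 1) (prime_gt0 pp).
  rewrite /index_iota subn1 /= => ->; rewrite sumr_const_nat subn1 /=.
  by rewrite ler_pdivlMr ?ltr0n ?prime_gt0 // -natrM ler_nat leq_trunc_div.
rewrite ler_wpM2l // sum_primes_dyadic // => k _; exact: sum_inv_primes_block.
Qed.

(** A survivor has either only primes up to [2 ^ w] or a prime above [2 ^ m]; the latter is at most
    [N <= 2 ^ l]. *)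
Lemma medium_sieve_count (R : realType) (eta : R) (N w m l L : nat) :
  0 <= eta <= 2^-1 -> (N <= 2 ^ l)%N -> (m <= l)%N ->
  (count (fun n => all (fun p => ~~ (p %| n)%N) (primes_in (2 ^ w) (2 ^ m)))
     (iota 1 N))%:R
  <= (2 ^ L)%:R + N%:R / (2 `^ eta) ^+ L
       * expR (16 * (\sum_(0 <= k < w) k.+1%:R^-1 + (2 `^ eta) ^+ w))
     + N%:R * \sum_(m <= k < l) 4 / k.+1%:R.
Proof.
move=> eta01 Nl ml.
apply: le_trans (lerD (smooth_count w L N eta01) (large_prime_count R N ml)).
have -> : \sum_(1 <= n < N.+1 | all (mem (primes_in 0 (2 ^ w))) (primes n)) 1
    = (count (fun n => all (mem (primes_in 0 (2 ^ w))) (primes n))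
         (iota 1 N))%:R :> R.
  by rewrite -sum1_count natr_sum /index_iota subn1.
rewrite -natrD ler_nat -count_predUI; apply: leq_trans (leq_addr _ _).
rewrite -!size_filter; apply: uniq_leq_size => [|n].
  by rewrite filter_uniq // iota_uniq.
rewrite !mem_filter mem_iota => /andP[/allP mn /andP[n0 nN]].
rewrite n0 nN !andbT /= -implyNb; apply/implyP => /allPn[p].
rewrite mem_primes => /and3P[pp _ pn] wp; apply/hasP; exists p => //.
have pN : (p <= N)%N by rewrite (leq_trans (dvdn_leq _ pn)).
rewrite mem_primes_in pp (leq_trans pN) // andbT /= ltnNge.
apply/negP => pm; have := mn p; rewrite pn mem_primes_in pp pm andbT ltnNge.
move: wp; rewrite inE mem_primes_in pp prime_gt0 //= => wp.
by move=> /(_ wp).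
Qed.

Lemma cover_interval (R : realFieldType) (N w m a : nat) :
  (w <= m <= a)%N ->
  (count (fun n => all (fun p => ~~ (p %| n)%N) (primes_in (2 ^ w) (2 ^ m)))
     (iota 1 N))%:R * \prod_(p <- primes_in 0 (2 ^ w)) (1 - p%:R^-1)
  <= (size (primes_in (2 ^ m) (2 ^ a)))%:R :> R ->
  exists c : nat -> nat, forall n, (0 < n <= N)%N ->
    exists2 p, p \in primes_in 0 (2 ^ a) & n = c p %[mod p].
Proof.
move=> /andP[wm ma]; rewrite -size_filter; set S := filter _ _ => SP.
have [c1 c1S] := @greedy_sieve R (primes_in 0 (2 ^ w)) S
  (primes_in_uniq _ _) (primes_in_prime _ _).
have {SP c1S} := le_trans c1S SP; rewrite ler_nat.
set T := filter _ _; set Q := primes_in _ _ => TQ.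
(* Small primes take their greedy class, medium primes the class 0, and the prime of index [i] in
   [Q] removes the survivor of index [i] in [T]. *)
exists (fun p => if (p <= 2 ^ w)%N then c1 p
  else if (p <= 2 ^ m)%N then 0%N else nth 0%N T (index p Q)) => n /andP[n0 nN].
have wm2 : (2 ^ w <= 2 ^ m)%N by rewrite leq_exp2l.
have ma2 : (2 ^ m <= 2 ^ a)%N by rewrite leq_exp2l.
case: (boolP (n \in S)) => nS; last first.
  move: nS; rewrite mem_filter mem_iota add1n ltnS n0 nN !andbT.
  case/allPn => p; rewrite mem_primes_in => /and3P[pp wp pm] /negPn pn.
  exists p; first by rewrite mem_primes_in pp prime_gt0 // (leq_trans pm).
  by rewrite leqNgt wp /= pm mod0n; apply/eqP.
case: (boolP (n \in T)) => nT; last first.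
  move: nT; rewrite mem_filter nS andbT => /allPn[p].
  rewrite mem_primes_in => /and3P[pp p0 pw] /negPn/eqP pn.
  exists p; last by rewrite pw.
  by rewrite mem_primes_in pp p0 (leq_trans pw) // (leq_trans wm2).
have nTQ : (index n T < size Q)%N by rewrite (leq_trans _ TQ) // index_mem.
have := mem_nth 0%N nTQ; set p := nth _ _ _ => pQ.
have := pQ; rewrite mem_primes_in => /and3P[pp mp pa].
exists p; first by rewrite mem_primes_in pp prime_gt0.
rewrite leqNgt (leq_ltn_trans wm2 mp) /= leqNgt mp /= /p.
by rewrite index_uniq ?primes_in_uniq // nth_index.
Qed.

(** * Numerical estimates and the choice of parameters *)

Lemma linear_le_exp2 (e : nat) : (6 <= e)%N -> (8 * e + 16 <= 2 ^ e)%N.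
Proof.
move=> /subnKC <-; elim: (e - 6)%N => // d IHd.
by rewrite addnS [(2 ^ _)%N]expnS; move: (2 ^ (6 + d))%N IHd => x; lia.
Qed.

Lemma ln2_bounds (R : realType) : 1 / 2 <= (ln 2 : R) <= 1.
Proof.
have := @le_ln1Dx R (- (1 / 2));
rewrite (_ : 1 + - (1 / 2) = 2^-1); last by lra.
rewrite lnV ?posrE // => lnV2; have ln1D := @le_ln1Dx R 1.
apply/andP; split; last by apply: ln1D; lra.
by have := lnV2 ltac:(lra); lra.
Qed.

Lemma expR1_le4 (R : realType) : expR 1 <= 4 :> R.
Proof.
have /andP[ln2 _] := ln2_bounds R.
rewrite -[leRHS]lnK ?posrE // ler_expR (_ : 4 = 2 ^+ 2 :> R); last by lra.
by rewrite lnXn //; lra.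
Qed.

(** With [a = 2 ^ b], Chebyshev gives at least [2 ^ (a - b - 1)] primes up to [2 ^ a]; at most
    [2 ^ (a - 2 * b)], hence at most half of that bound, lie in the removed part. *)
Lemma size_primes_top (b : nat) : (6 <= b)%N ->
  (2 ^ (2 ^ b - b - 2)
   <= size (primes_in (2 ^ (2 ^ b - 2 * b)) (2 ^ 2 ^ b)))%N.
Proof.
move=> b6; have ab := linear_le_exp2 b6; set a := (2 ^ b)%N in ab *.
have aS : a = a.-1.+1 by lia.
have : (2 ^ a.-1 <= 2 ^ b * size (primes_in 0 (2 ^ a)))%N.
  by have := chebyshev_lower a.-1; rewrite -aS.
rewrite (@primes_in_cat _ (2 ^ (a - 2 * b))) ?leq_exp2l ?leq_subr // size_cat.
have : (size (primes_in 0 (2 ^ (a - 2 * b))) <= 2 ^ (a - 2 * b))%N.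
  by rewrite size_filter (leq_trans (count_size _ _)) // size_iota subSS subn0.
set s := size _; set t := size _ => sle.
have -> : (a.-1 = b + (a - b - 2).+1)%N by lia.
rewrite expnD leq_pmul2l ?expn_gt0 //.
suff : (2 ^ (a - 2 * b) <= 2 ^ (a - b - 2))%N by rewrite expnS; lia.
by rewrite leq_exp2l //; lia.
Qed.

(** The choice of [q] makes [t ^+ (e * 2 ^ q) = 2 ^ e = b] and, since [b - 1 = q + e + 7], makes the
    denominator [2 ^ (128 * b)], which outweighs the exponential. *)
Lemma smooth_term_le (R : realType) (e b q : nat) (N t : R) :
  (6 <= e)%N -> 0 <= N -> b = (2 ^ e)%N -> q = (b - e - 8)%N ->
  t ^+ (2 ^ q) = 2 ->
  N / t ^+ (2 ^ b.-1)
    * expR (16 * (\sum_(0 <= k < e * 2 ^ q) k.+1%:R^-1 + t ^+ (e * 2 ^ q)))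
  <= N / (2 ^ b)%:R.
Proof.
move=> e6 N0 bE qE tq; have be := linear_le_exp2 e6; rewrite -bE in be.
set w := (e * _)%N.
have -> : t ^+ w = b%:R by rewrite /w mulnC exprM tq bE natrX.
have -> : t ^+ (2 ^ b.-1) = 2 ^+ (128 * b).
  have -> : (2 ^ b.-1 = 2 ^ q * (128 * b))%N.
    rewrite -[128%N]/(2 ^ 7)%N [in RHS]bE -!expnD; congr (2 ^ _)%N; lia.
  by rewrite exprM tq.
rewrite -mulrA ler_wpM2l //.
have H : \sum_(0 <= k < w) k.+1%:R^-1 <= b%:R + 1 :> R.
  apply: le_trans (harmonic_dyadic_le R b).
  rewrite [leRHS](@big_cat_nat _ _ _ w) //=.
    by rewrite lerDl sumr_ge0 // => i _; rewrite invr_ge0.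
  have -> : (b = e + (b - e))%N by lia.
  by rewrite expnD /w leq_mul ?leq_exp2l ?(ltnW (ltn_expl _ _)) //; lia.
have b1 : 1 <= b%:R :> R by rewrite ler1n bE expn_gt0.
(* The exponent is at most [16 * (2 * b + 1) <= 48 * b], and [expR 1 <= 4]. *)
apply: (@le_trans _ _ (2 ^- (128 * b) * 2 ^+ (96 * b))).
  rewrite ler_wpM2l ?invr_ge0 ?exprn_ge0 //.
  apply: (@le_trans _ _ (expR (48 * b%:R))); first by rewrite ler_expR; lra.
  have -> : 48 * b%:R = (48 * b)%:R * 1 :> R by rewrite mulr1 natrM.
  rewrite expRM_natl.
  have -> : (96 * b = 2 * (48 * b))%N by lia.
  rewrite [2 ^+ _]exprM.
  apply: lerXn2r; rewrite ?nnegrE ?expR_ge0 ?exprn_ge0 //.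
  by apply: le_trans (expR1_le4 R) _; lra.
have -> : (128 * b = 32 * b + 96 * b)%N by lia.
rewrite exprD invfM -mulrA mulVf ?mulr1 ?expf_neq0 ?pnatr_eq0 // natrX.
rewrite lef_pV2 ?posrE ?exprn_gt0 // ler_eXn2l ?ltr1n //; lia.
Qed.

Lemma sieve_parameters (R : realType) (e : nat) : (6 <= e)%N ->
  let b := (2 ^ e)%N in
  let a := (2 ^ b)%N in
  exists c : nat -> nat, forall n,
    (0 < n <= e * 2 ^ (a + b - 2 * e - 16))%N ->
    exists2 p, p \in primes_in 0 (2 ^ a) & n = c p %[mod p].
Proof.
move=> e6 b a; have be := linear_le_exp2 e6; rewrite -/b in be.
have b6 : (6 <= b)%N by lia.
have ab := linear_le_exp2 b6; rewrite -/a in ab.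
set N := (e * _)%N; set q := (b - e - 8)%N.
set w := (e * 2 ^ q)%N.
have q0 : (0 < q)%N by rewrite /q; lia.
have wa : (4 * w <= a)%N.
  rewrite /a; have -> : (b = e + (q + 8))%N by rewrite /q; lia.
  rewrite !expnD /w mulnCA [(4 * _)%N]mulnC.
  by apply: leq_mul; [exact/ltnW/ltn_expl | exact: leq_mul].
have NL : (N <= 2 ^ (a + b))%N.
  have -> : (a + b = e + (a + b - e))%N by lia.
  by rewrite expnD leq_mul ?leq_exp2l ?(ltnW (ltn_expl _ _)) //; lia.
apply: (@cover_interval R N w (a - 2 * b) a); first by apply/andP; lia.
have tq : (2 `^ (2 ^ q)%:R^-1) ^+ (2 ^ q) = 2 :> R.
  rewrite -powR_mulrn ?powR_ge0 // -powRrM mulVf ?powRr1 //.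
  by rewrite pnatr_eq0 expn_eq0.
have eta01 : 0 <= ((2 ^ q)%:R^-1 : R) <= 2^-1.
  rewrite invr_ge0 ler0n /= lef_pV2 ?posrE ?ltr0n ?expn_gt0 //.
  by rewrite ler_nat -{1}[2%N]expn1 leq_exp2l.
(* Rankin's exponent is [1 / 2 ^ q]. As [2 ^ b.-1 = a / 2], the trivially counted numbers are those
   up to [sqrt x]. *)
have M := @medium_sieve_count R _ N w (a - 2 * b) (a + b) (2 ^ b.-1) eta01 NL _.
have {}M := M ltac:(lia).
have a0 : 0 < a%:R :> R by rewrite ltr0n expn_gt0.
have b0 : 0 < b%:R :> R by rewrite ltr0n expn_gt0.
have w0 : 0 < w%:R :> R by rewrite ltr0n muln_gt0 expn_gt0; lia.
have N0 : 0 <= N%:R :> R by rewrite ler0n.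
have {}M : (count (fun n => all (fun p => ~~ (p %| n)%N)
      (primes_in (2 ^ w) (2 ^ (a - 2 * b)))) (iota 1 N))%:R
    <= 32 * (N%:R * b%:R / a%:R) :> R.
  apply: le_trans M _.
  have T1 : (2 ^ (2 ^ b.-1))%:R <= N%:R * b%:R / a%:R :> R.
    rewrite ler_pdivlMr // -!natrM ler_nat /N.
    apply: (@leq_trans (2 ^ (a + b - 2 * e - 16))); last first.
      by rewrite mulnAC leq_pmull // muln_gt0 expn_gt0; lia.
    rewrite /a -expnD leq_exp2l //; rewrite -/a.
    have : (a = 2 * 2 ^ b.-1)%N by rewrite -expnS prednK //; lia.
    by lia.
  have T2 := smooth_term_le e6 N0 (erefl b) (erefl q) tq.
  rewrite -/w -/a in T2.
  have {}T2 := le_trans T2 (_ : _ <= N%:R * b%:R / a%:R).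
  have {}T2 := T2 ltac:(
    by rewrite ler_wpM2r ?invr_ge0 ?(ltW a0) // ler_peMr // ler1n; lia).
  (* There are [3 * b] terms, each at most [8 / a] because [k.+1 >= a / 2]. *)
  have T3 : \sum_(a - 2 * b <= k < a + b) 4 / k.+1%:R <= 24 * b%:R / a%:R :> R.
    apply: (@le_trans _ _ (\sum_(a - 2 * b <= k < a + b) (8 / a%:R))).
      apply: ler_sum_nat => k /andP[ak ka].
      rewrite ler_pdivlMr // mulrAC ler_pdivrMr ?ltr0n // -!natrM ler_nat; lia.
    rewrite sumr_const_nat -[(8 / _) *+ _]mulr_natl mulrA.
    rewrite ler_wpM2r ?invr_ge0 ?(ltW a0) //.
    by rewrite -!natrM ler_nat; lia.
  have z0 : 0 <= N%:R * b%:R / a%:R :> R.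
    by rewrite !mulr_ge0 ?invr_ge0 ?(ltW a0).
  have := ler_wpM2l N0 T3; move: z0 T1 T2.
  have -> : N%:R * (24 * b%:R / a%:R) = 24 * (N%:R * b%:R / a%:R) :> R.
    by rewrite !mulrA [N%:R * _]mulrC.
  move: (N%:R * b%:R / a%:R) ((2 ^ 2 ^ b.-1)%:R) (_ * expR _).
  by move: (_ * \sum_(_ <= _ < _) _) => u z x y; lra.
apply: (@le_trans _ _ (32 * (N%:R * b%:R / a%:R) * (2 / w%:R))).
  apply: ler_pM => //; last by apply: mertens_le; rewrite -(ltr0n R).
  rewrite big_seq prodr_ge0 // => p; rewrite mem_primes_in => /and3P[pp p0 _].
  by rewrite subr_ge0 invf_le1 ?ltr0n // ler1n.
apply: (@le_trans _ _ (2 ^ (a - b - 2))%:R); last first.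
  by rewrite ler_nat size_primes_top.
have -> : 32 * (N%:R * b%:R / a%:R) * (2 / w%:R)
    = (64 * N * b)%:R / (a * w)%:R :> R.
  by rewrite (natrM _ a) (natrM _ _ b) (natrM _ 64); field; rewrite !gt_eqF.
rewrite ler_pdivrMr -?natrM ?ler_nat ?ltr0n; last first.
  by rewrite -(ltr0n R) natrM mulr_gt0.
(* Both sides become [e * 2 ^ (a + b - e - 10)]: the 16 in [N] is chosen to make them agree. *)
have -> : (64 * N * b = e * 2 ^ (6 + (a + b - 2 * e - 16) + e))%N.
  by rewrite !expnD /N -/b; ring.
have -> : (2 ^ (a - b - 2) * (a * w) = e * 2 ^ (a - b - 2 + b + q))%N.
  by rewrite !expnD /w -/a; ring.
by rewrite leq_pmul2l ?leq_exp2l //; lia.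
Qed.

Local Open Scope nat_scope.

(** * Square-free numbers in a residue class *)

Lemma crt_prime_squares (s : seq nat) (d : nat -> nat) :
  uniq s -> all prime s ->
  exists r, {in s, forall p, r = d p %[mod p ^ 2]}.
Proof.
elim: s => [|p s IHs] /=; first by exists 0.
move=> /andP[ps us] /andP[pp sp]; have [r rP] := IHs us sp.
have cop : coprime (p ^ 2) (\prod_(q <- s) q ^ 2).
  rewrite coprimeXl // prime_coprime // Euclid_dvd_prod // big_has.
  apply/hasPn => q qs; rewrite Euclid_dvdX // andbT dvdn_prime2 //.
    by apply: contraNneq ps => ->.
  exact: (allP sp).
exists (chinese (p ^ 2) (\prod_(q <- s) q ^ 2) (d p) r) => q.
rewrite inE => /orP[/eqP ->|qs]; first by rewrite chinese_modl.
have dv : q ^ 2 %| \prod_(q <- s) q ^ 2 by rewrite (big_rem q) //= dvdn_mulr.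
by rewrite -(rP q qs) -[LHS](modn_dvdm _ dv) chinese_modr // modn_dvdm.
Qed.

(** Solutions [t] agree modulo [d], so [t %/ d] determines [t]. *)
Lemma count_dvd_linear (d r W T : nat) : 0 < d -> coprime d W ->
  count (fun t => d %| r + W * t) (iota 1 T) <= T %/ d + 1.
Proof.
move=> d0 dW; rewrite -size_filter addn1 -(size_iota 0 (T %/ d).+1).
set S := filter _ _; rewrite -(size_map (divn^~ d)).
have SP t : t \in S -> (0 < t <= T) && (d %| r + W * t).
  by rewrite mem_filter mem_iota add1n ltnS andbC.
apply: uniq_leq_size => [|q /mapP[t /SP /andP[/andP[_ tT] _] ->]]; last first.
  by rewrite mem_iota add0n ltnS leq_div2r.
rewrite map_inj_in_uniq ?filter_uniq ?iota_uniq // => t u.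
wlog tu : t u / t <= u.
  move=> H tS uS E; case: (leqP t u) => [tu|/ltnW ut]; first exact: H.
  by apply/esym; apply: H.
move=> /SP/andP[_ tS] /SP/andP[_ uS] E.
suff : d %| u - t.
  rewrite -(eqn_mod_dvd _ tu) => /eqP F.
  by rewrite (divn_eq t d) (divn_eq u d) E F.
rewrite -(Gauss_dvdr _ dW) mulnBr -(dvdn_addr _ tS).
by rewrite addnAC -addnA subnK ?leq_mul2l ?tu ?orbT.
Qed.

(** The bound [1 / p ^ 2 <= 1 / (p - 1) - 1 / p] telescopes to at most [1 / X]. *)
Lemma sum_div_squares (T X Y : nat) : 0 < X ->
  X * \sum_(X.+1 <= p < Y.+1) T %/ p ^ 2 <= T.
Proof.
move=> X0; case: (ltnP X Y) => [XY|YX]; last by rewrite big_geq ?muln0.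
have X0' : (0 < X%:R :> rat)%R by rewrite ltr0n.
have tele d : (\sum_(X.+1 <= p < (X + d).+1) ((p ^ 2)%:R)^-1
    <= X%:R^-1 - (X + d)%:R^-1 :> rat)%R.
  elim: d => [|d IHd]; first by rewrite addn0 big_geq // subrr.
  rewrite addnS big_nat_recr ?ltnS ?leq_addr //=.
  move: IHd; set n := X + d; have n0 : (0 < n%:R :> rat)%R.
    by rewrite ltr0n /n; lia.
  rewrite natrX -[(n.+1)%:R%R]natr1.
  suff : ((n%:R + 1) ^- 2 <= n%:R^-1 - (n%:R + 1)^-1 :> rat)%R by lra.
  move: (n%:R)%R n0 => x x0.
  have -> : (x^-1 - (x + 1)^-1 = (x * (x + 1))^-1)%R.
    by field; rewrite !gt_eqF //; lra.
  have x1 : (0 < x + 1)%R by lra.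
  by rewrite lef_pV2 ?posrE ?mulr_gt0 ?exprn_gt0 //; nra.
rewrite -(ler_nat rat) natrM natr_sum -ler_pdivlMl // mulrC.
apply: (@le_trans _ _ (T%:R * \sum_(X.+1 <= p < Y.+1) ((p ^ 2)%:R)^-1)%R).
  rewrite mulr_sumr; apply: ler_sum_nat => p /andP[Xp _].
  rewrite ler_pdivlMr ?ltr0n ?expn_gt0 ?(leq_trans _ Xp) // -natrM ler_nat.
  exact: leq_trunc_div.
rewrite ler_wpM2l // -(subnKC (ltnW XY)); apply: le_trans (tele _) _.
by rewrite lerBlDr lerDl invr_ge0.
Qed.

(* Among [r + W * t] with [1 <= t <= T], a prime square [p ^ 2] coprime to [W]
   divides at most [T / p ^ 2 + 1] terms, and only [p <= 2 * W] matters. *)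
Lemma squarefree_in_class (X r : nat) :
  let W := (\prod_(p <- primes_in 0 X) p) ^ 2 in
  4 <= X -> r < W ->
  {in primes_in 0 X, forall p, ~~ (p ^ 2 %| r)} ->
  exists2 t, 0 < t <= 4 * W & squarefree (r + W * t).
Proof.
move=> W X4 rW rP; have W0 : 0 < W by lia.
set Y := 2 * W; set T := 4 * W.
pose B p t := prime p && (p ^ 2 %| r + W * t).
have cop p : prime p -> X < p -> coprime (p ^ 2) W.
  move=> pp Xp; rewrite coprimeXl // coprimeXr // prime_coprime //.
  rewrite Euclid_dvd_prod // big_has; apply/hasPn => q.
  rewrite mem_primes_in => /and3P[qp _ qX]; rewrite dvdn_prime2 //.
  by apply: contraTneq Xp => ->; rewrite -leqNgt.
(* The quotients sum to at most [T / X <= W], and the extra ones to at most [Y = 2 * W]; together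
   they stay below [T = 4 * W]. *)
have : count (fun t => has (B^~ t) (index_iota X.+1 Y.+1)) (iota 1 T) < T.
  apply: leq_ltn_trans (count_has_le _ _ _) _.
  apply: (@leq_ltn_trans (\sum_(X.+1 <= p < Y.+1) (T %/ p ^ 2 + 1))).
    rewrite !big_nat; apply: leq_sum => p /andP[Xp _]; rewrite /B.
    case: (boolP (prime p)) => [pp|_] /=; last by rewrite count_pred0.
    by rewrite count_dvd_linear ?cop // expn_gt0 prime_gt0.
  rewrite big_split /= sum_nat_const_nat.
  have := @sum_div_squares T X Y; rewrite /T /Y in X4 *.
  move: (\sum_(_ <= _ < _) _) => S; nia.
move=> ltT.
have : ~~ all (fun t => has (B^~ t) (index_iota X.+1 Y.+1)) (iota 1 T).
  by rewrite all_count size_iota neq_ltn ltT.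
case/allPn => t; rewrite mem_iota add1n ltnS => tT /hasPn tB.
exists t => // d dm; have /andP[t0 tT4] := tT.
have m0 : 0 < r + W * t by rewrite addn_gt0 muln_gt0 W0 t0 orbT.
have d0 : 0 < d by have := dvdn_gt0 m0 dm; rewrite expn_gt0 orbF.
case: (ltngtP d 1) => // [|d1]; first by case: d d0 {dm}.
have pp := pdiv_prime d1; set p := pdiv d in pp.
have pm : p ^ 2 %| r + W * t.
  by rewrite (dvdn_trans _ dm) // dvdn_exp2r ?pdiv_dvd.
have [pX|Xp] := leqP p X.
  have ps : p \in primes_in 0 X by rewrite mem_primes_in pp prime_gt0.
  have := rP p ps; rewrite -(dvdn_addl _ (_ : p ^ 2 %| W * t)) ?pm //.
  by rewrite dvdn_mulr // dvdn_exp2r // (big_rem p) //= dvdn_mulr.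
have := tB p; rewrite mem_index_iota Xp /B pp pm /= ltnS.
case: (leqP p Y) => [_ /(_ isT)//|Yp _].
(* Here [p > 2 * W] gives [p ^ 2 > 4 * W ^ 2 + W > r + W * t]. *)
have := dvdn_leq m0 pm; rewrite leqNgt => /negP[].
move: Yp tT4; rewrite -mulnn /Y /T -/W; nia.
Qed.

(* With [2 ^ a] the sieving limit, [n] in the covered interval corresponds to
   the shift [u = n - U - 1]. *)
Lemma squarefree_avoiding (N a U : nat) (c : nat -> nat) :
  2 <= a -> 2 * U < N ->
  2 ^ a + U < 2 ^ size (primes_in 0 (2 ^ a)) ->
  (forall n, 0 < n <= N ->
    exists2 p, p \in primes_in 0 (2 ^ a) & n = c p %[mod p]) ->
  exists2 m, squarefree m /\
      2 ^ size (primes_in 0 (2 ^ a)) <= m <= 2 ^ 2 ^ (a + 4) &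
    forall u : int, `|u|%N <= U -> composite (m%:Z + u)%R.
Proof.
move=> a2 UN big cP; set s := primes_in 0 (2 ^ a).
have us : uniq s by exact: primes_in_uniq.
have sp : all prime s by exact: primes_in_prime.
(* Modulo [p] this is [U + 1 - c p], so [m + u] becomes [n - c p] for [n = u + U + 1]. *)
pose v p := U.+1 + p.-1 * c p.
(* Adding [p] keeps the class modulo [p] but leaves the class 0 modulo [p ^ 2]. *)
pose d p := if p ^ 2 %| v p then v p + p else v p.
have dv p : d p = v p %[mod p].
  by rewrite /d; case: ifP => // _; rewrite modnDr.
have dn p : prime p -> ~~ (p ^ 2 %| d p).
  move=> pp; rewrite /d; case: ifP => [vp|/negbT //].
  rewrite dvdn_addr //; apply/negP => /dvdn_leq-/(_ (prime_gt0 pp)).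
  by have := prime_gt1 pp; rewrite -mulnn; nia.
have [r0 r0P] := @crt_prime_squares s d us sp.
set M := \prod_(p <- s) p; set W := M ^ 2.
have sM q : q \in s -> q %| M.
  by move=> qs; rewrite /M (big_rem q) //= dvdn_mulr.
have M1 : 2 ^ size s <= M.
  rewrite -iter_muln_1 -count_predT -big_const_seq /M !big_seq.
  by apply: leq_prod => p ps; rewrite prime_gt1 // (allP sp).
have M2 : M <= 2 ^ 2 ^ a.+1 by exact: primorial_le.
have M0 : 0 < M by apply: leq_trans M1; rewrite expn_gt0.
have W0 : 0 < W by rewrite expn_gt0 M0.
have MW : M <= W by rewrite /W -mulnn leq_pmulr.
set r := r0 %% W.
have rP p : p \in s -> r = d p %[mod p ^ 2].
  by move=> ps; rewrite -(r0P p ps) modn_dvdm // dvdn_exp2r // sM.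
have rn : {in s, forall p, ~~ (p ^ 2 %| r)}.
  by move=> p ps; rewrite /dvdn rP // -/(dvdn _ _) dn // (allP sp).
have a4 : 4 <= 2 ^ a by rewrite (@leq_exp2l 2 2).
have rW : r < W by rewrite ltn_mod.
have [t /andP[t0 tW] sqm] := @squarefree_in_class (2 ^ a) r a4 rW rn.
rewrite -/s -/M -/W in tW sqm; set m := r + W * t in sqm.
have Wm : W <= m by rewrite /m (leq_trans (leq_pmulr W t0)) // leq_addl.
exists m.
  split=> //; rewrite (leq_trans M1) ?(leq_trans MW) //=.
  (* From [r < W] and [t <= 4 * W] follows [m <= 8 * W ^ 2 = 2 ^ 3 * M ^ 4]. *)
  apply: (@leq_trans (2 ^ (3 + 4 * 2 ^ a.+1))).
    apply: (@leq_trans (2 ^ 3 * M ^ 4)).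
      rewrite -[4]/(2 * 2) expnM -/W; rewrite /m -mulnn; nia.
    by rewrite expnD leq_mul2l /= mulnC expnM leq_exp2r.
  rewrite leq_exp2l // expnS expnD -[2 ^ 4]/16.
  by move: (2 ^ a) a4 => x; lia.
(* This makes [m + u] exceed every sieving prime, so the prime dividing it is a proper divisor. *)
move=> u uU; have mU : 2 ^ a + U < m.
  by rewrite (leq_trans big) // (leq_trans M1) // (leq_trans MW).
have [n nE n0] : exists2 n, (n%:Z = u + U.+1%:Z)%R & 0 < n <= N.
  by exists `|(u + U.+1%:Z)%R|%N; lia.
have [p ps np] := cP n n0.
have pp : prime p by exact: (allP sp).
have p2 : p <= 2 ^ a by move: ps; rewrite mem_primes_in => /and3P[].
have [k kE] : exists k, (m%:Z + u = k%:Z)%R by exists `|(m%:Z + u)%R|%N; lia.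
have kU : k + U.+1 = m + n by lia.
have pk : p %| k.
  have : k + U.+1 = 0 + U.+1 %[mod p].
    have mv : m = v p %[mod p].
      rewrite /m -modnDmr -modnMml (eqP (_ : p %| W)) ?mul0n ?mod0n ?addn0.
        rewrite -(dv p) -[LHS](@modn_dvdm (p ^ 2)) ?dvdn_mulr // rP //.
        by rewrite modn_dvdm // dvdn_mulr.
      by rewrite /W dvdn_mulr // sM.
    rewrite kU -modnDm mv np modnDm /v -addnA -mulSnr prednK ?prime_gt0 //.
    by rewrite addnC mulnC modnMDl.
  by move/eqP; rewrite eqn_modDr mod0n.
have pkl : p < k by lia.
rewrite kE /composite absz_nat; apply/andP; split.
  by have := prime_gt1 pp; lia.
apply: contraL pk => kp; rewrite dvdn_prime2 //; lia.
Qed.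

Local Open Scope ring_scope.

(** * Iterated logarithms *)

Lemma ln_le_exp2 (R : realType) (x : R) (n : nat) :
  0 < x -> x <= (2 ^ n)%:R -> ln x <= n%:R.
Proof.
move=> x0 xn; have : ln x <= ln (2 ^ n)%:R :> R.
  by rewrite ler_ln ?posrE ?ltr0n ?expn_gt0.
move=> /le_trans; apply; rewrite natrX lnXn // -[leLHS]mulr_natl -[leRHS]mulr1.
by rewrite ler_wpM2l //; have /andP[] := ln2_bounds R.
Qed.

Lemma ln_ge_exp2 (R : realType) (x : R) (n : nat) :
  (2 ^ n)%:R <= x -> n%:R / 2 <= ln x.
Proof.
move=> nx; have n0 : 0 < (2 ^ n)%:R :> R by rewrite ltr0n expn_gt0.
have : ln (2 ^ n)%:R <= ln x :> R.
  by rewrite ler_ln ?posrE ?(lt_le_trans n0 nx).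
apply: le_trans; rewrite natrX lnXn // -[leRHS]mulr_natl ler_wpM2l //.
by have /andP[] := ln2_bounds R; lra.
Qed.

(** The four logarithms satisfy [L1 <= 2 ^ (a + 4)], [L2 <= 2 ^ b.+1], [L3 >= 2 ^ (e - 2)] and
    [L4 <= 2 * e]. Hence the quotient is at most [e * 2 ^ (a + b - 2 * e + 10)], and
    [26 = 10 + 16]. *)
Lemma avoidance_bound_le (R : realType) (e b a m : nat) :
  (6 <= e)%N -> b = (2 ^ e)%N -> a = (2 ^ b)%N ->
  (2 ^ 2 ^ (a - b - 2) <= m <= 2 ^ 2 ^ (a + 4))%N ->
  avoidance_bound R m%:Z <= (2 ^ 26 * (e * 2 ^ (a + b - 2 * e - 16)))%:R.
Proof.
move=> e6 bE aE /andP[mlo mhi].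
have be := linear_le_exp2 e6; rewrite -bE in be.
have b6 : (6 <= b)%N by lia.
have ab := linear_le_exp2 b6; rewrite -aE in ab.
have m0 : 0 < m%:R :> R by rewrite ltr0n (leq_trans _ mlo) ?expn_gt0.
rewrite /avoidance_bound pmulrn; set L1 := ln m%:R.
set L2 := ln L1; set L3 := ln L2; set L4 := ln L3.
have L1hi : L1 <= (2 ^ (a + 4))%:R by apply: ln_le_exp2; rewrite ?ler_nat.
have half n : (0 < n)%N -> (2 ^ n)%:R / 2 = (2 ^ n.-1)%:R :> R.
  by case: n => // n _; rewrite expnS natrM mulrAC divff ?mul1r ?pnatr_eq0.
have L1lo : (2 ^ (a - b - 3))%:R <= L1.
  have -> : (a - b - 3 = (a - b - 2).-1)%N by lia.
  by rewrite -half; [apply: ln_ge_exp2; rewrite ler_nat | lia].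
have L10 : 0 < L1 by apply: lt_le_trans L1lo; rewrite ltr0n expn_gt0.
have L2hi : L2 <= (2 ^ b.+1)%:R.
  apply: le_trans (ln_le_exp2 L10 L1hi) _.
  by rewrite ler_nat expnS -aE; lia.
have L2lo : (2 ^ (b - 2))%:R <= L2.
  have -> : (b - 2 = b.-1.-1)%N by lia.
  apply: le_trans (ln_ge_exp2 L1lo); rewrite -half; last by lia.
  rewrite ler_wpM2r ?invr_ge0 // ler_nat.
  have : (a = 2 * 2 ^ b.-1)%N by rewrite -expnS prednK //; lia.
  by lia.
have L20 : 0 < L2 by apply: lt_le_trans L2lo; rewrite ltr0n expn_gt0.
have L3hi : L3 <= (2 ^ e.+1)%:R.
  apply: le_trans (ln_le_exp2 L20 L2hi) _.
  by rewrite ler_nat expnS -bE; lia.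
have L3lo : (2 ^ (e - 2))%:R <= L3.
  have -> : (e - 2 = e.-1.-1)%N by lia.
  apply: le_trans (ln_ge_exp2 L2lo); rewrite -half; last by lia.
  rewrite ler_wpM2r ?invr_ge0 // ler_nat.
  have : (b = 2 * 2 ^ e.-1)%N by rewrite -expnS prednK //; lia.
  by lia.
have p0 : 0 < (2 ^ (e - 2))%:R :> R by rewrite ltr0n expn_gt0.
have L30 : 0 < L3 by apply: lt_le_trans L3lo.
have L4hi : L4 <= (2 * e)%:R.
  apply: le_trans (ln_le_exp2 L30 L3hi) _; rewrite ler_nat; lia.
rewrite ler_pdivrMr ?exprn_gt0 //.
apply: (@le_trans _ _ ((2 ^ (a + 4))%:R * (2 ^ b.+1)%:R * (2 * e)%:R)).
  apply: (@le_trans _ _ (L1 * L2 * (2 * e)%:R)).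
    by rewrite ler_wpM2l // mulr_ge0 // ltW.
  by rewrite ler_wpM2r // ler_pM // ltW.
apply: (@le_trans _ _ ((2 ^ 26 * (e * 2 ^ (a + b - 2 * e - 16)))%:R
    * (2 ^ (e - 2))%:R ^+ 2)).
  rewrite -natrX -!natrM ler_nat -expnM.
  have -> : (2 ^ (a + 4) * 2 ^ b.+1 * (2 * e)
      = e * 2 ^ ((a + 4) + b.+1 + 1))%N by rewrite !expnD expn1; ring.
  have -> : (2 ^ 26 * (e * 2 ^ (a + b - 2 * e - 16)) * 2 ^ ((e - 2) * 2)
      = e * 2 ^ (26 + (a + b - 2 * e - 16) + (e - 2) * 2))%N.
    by rewrite !expnD; ring.
  by rewrite leq_mul2l leq_exp2l //; lia.
apply: ler_wpM2l => //.
by apply: lerXn2r; rewrite ?nnegrE ?(ltW p0) ?(ltW L30).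
Qed.

(** * Infinitude of the square-free prime-avoiding integers *)

Local Open Scope classical_set_scope.
Local Open Scope ring_scope.

Theorem theorem1p1 (R : realType) :
  exists c : R, 0 < c /\
    infinite_set
      [set m : nat | (0 < m)%N /\ squarefree m /\ prime_avoiding c m%:Z].
Proof.
(* The factor [2 ^- 26] brings the avoidance bound down to [N], and a further [2 ^- 2] to [N / 4],
   so that the shifts fit into an interval of length [N]. *)
exists (2 ^- 28); split; first by rewrite invr_gt0 exprn_gt0.
(* If [s] listed all such integers, this [e] would be at least each of them, yet the [m] built from
   [e] exceeds [e]. *)
move=> /finite_seqP[s sE]; pose e := (6 + \max_(i <- s) i)%N.
have e6 : (6 <= e)%N by rewrite leq_addr.
set b := (2 ^ e)%N; set a := (2 ^ b)%N.
have be := linear_le_exp2 e6; rewrite -/b in be.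
have b6 : (6 <= b)%N by lia.
have ab := linear_le_exp2 b6; rewrite -/a in ab.
have [c cP] := sieve_parameters R e6; rewrite /= -/b -/a in cP.
set N := (e * _)%N in cP.
have N0 : (0 < N)%N by rewrite muln_gt0 expn_gt0 andbT; lia.
have NL : (N <= 2 ^ (a + b))%N.
  have -> : (a + b = e + (a + b - e))%N by lia.
  by rewrite expnD leq_mul ?leq_exp2l ?(ltnW (ltn_expl _ _)) //; lia.
have Psz : (2 ^ (a - b - 2) <= size (primes_in 0 (2 ^ a)))%N.
  apply: leq_trans (size_primes_top b6) _; rewrite -/a.
  by rewrite (@primes_in_cat 0 (2 ^ (a - 2 * b))) ?leq_exp2l ?leq_subr //
    size_cat leq_addl.
have big : (2 ^ a + N %/ 4 < 2 ^ size (primes_in 0 (2 ^ a)))%N.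
  apply: (@leq_trans (2 ^ (a + b).+1)).
    rewrite expnS mul2n -addnn -addSn leq_add //; last first.
      by rewrite (leq_trans (leq_div _ _)).
    by rewrite ltn_exp2l //; lia.
  rewrite leq_exp2l //; apply: leq_trans Psz.
  by apply: leq_trans (linear_le_exp2 (_ : 6 <= a - b - 2)%N); lia.
have a2 : (2 <= a)%N by lia.
have UN : (2 * (N %/ 4) < N)%N.
  by move: (N) (leq_trunc_div N 4) N0 => n; move: (n %/ 4)%N => u; lia.
have [m [sqm /andP[mlo mhi]] mcomp] := squarefree_avoiding a2 UN big cP.
have m1 : (2 ^ 2 ^ (a - b - 2) <= m)%N by rewrite (leq_trans _ mlo) ?leq_exp2l.
have em : (e < m)%N.
  apply: leq_trans m1; apply: leq_trans (ltnW (ltn_expl _ _)) => //.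
  by apply: leq_trans (ltnW (ltn_expl _ _)) => //; lia.
have : [set` s] m.
  rewrite -sE /=; split; first by lia.
  split=> // u uc; apply: mcomp; rewrite leq_divRL // -(ler_nat R) natrM.
  have m1hi : (2 ^ 2 ^ (a - b - 2) <= m <= 2 ^ 2 ^ (a + 4))%N by rewrite m1.
  have := avoidance_bound_le R e6 (erefl b) (erefl a) m1hi.
  rewrite -/N natrM natrX; move: uc; rewrite ler_pdivlMl ?exprn_gt0 //.
  rewrite pmulrn -abszE.
  by move=> /le_trans H /H; lra.
move=> ms; have : (m <= \max_(i <- s) i)%N by exact: leq_bigmax_seq.
move: em; rewrite /e ltnNge => /negP em mM; apply: em.
exact: leq_trans mM (leq_addl _ _).
Qed.
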